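(* Let $\lambda\in(-\pi/2,\pi/2)$ satisfy $\cos\lambda<1/\sqrt{2}$, and let $f\in\mathcal{R}(\lambda)$ be a $\lambda$-Robertson function. Then $f$ is bounded on the unit disk $\mathbb{D}$.
   Context: $\mathbb{D}=\{z\in\mathbb{C}:|z|<1\}$. $\mathcal{A}$ is the family of functions $f$ analytic in $\mathbb{D}$ with $f(0)=0$ and $f'(0)=1$. For $\lambda\in(-\pi/2,\pi/2)$, a function $f\in\mathcal{A}$ is called a $\lambda$-Robertson function if $$\operatorname{Re}\left\{e^{-i\lambda}\left(1+\frac{zf''(z)}{f'(z)}\right)\right\}>0\quad\text{for all } z\in\mathbb{D}$$ (in particular $f'(z)\neq 0$ for all $z\in\mathbb{D}$, so that the expression is defined). $\mathcal{R}(\lambda)$ denotes the set of all $\lambda$-Robertson functions. *)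

(* Defs.v *)
From Stdlib Require Export Reals.
From Coquelicot Require Export Coquelicot.
Open Scope R_scope.

Definition unit_disk (z : C) : Prop := Cmod z < 1.

Definition cis (t : R) : C := (cos t, sin t).

(* Local expansion in convergent power series at every point of [D]. For [D]
   open, [r] may be taken so small that the disk lies inside [D], so the values
   of [f] outside [D] play no role. *)
Definition analytic_on (D : C -> Prop) (f : C -> C) : Prop :=
  forall z0 : C, D z0 ->
    exists (a : nat -> C) (r : R), 0 < r /\
      forall z : C, Cmod (z - z0) < r ->
        is_pseries (K := C_AbsRing) (V := C_NormedModule) a (z - z0)%C (f z).

(* [C_derive f z] is the limit of the difference quotient with increments
   parallel to the real axis; it is the complex derivative wherever that
   exists, in particular at every point of analyticity of [f]. *)
Definition class_A (f : C -> C) : Prop :=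
  analytic_on unit_disk f /\ f 0 = 0 /\ C_derive f 0 = 1.

Definition Robertson (lam : R) (f : C -> C) : Prop :=
  class_A f /\
  forall z : C, unit_disk z ->
    C_derive f z <> 0 /\
    0 < Re (cis (- lam) * (1 + z * C_derive (C_derive f) z / C_derive f z)).

Definition bounded_on (D : C -> Prop) (f : C -> C) : Prop :=
  exists M : R, forall z : C, D z -> Cmod (f z) <= M.

(* Main.v *)
From Stdlib Require Import Lra Lia.
Require Import Defs.

(** The function [q z = z f'' z / f' z] can be written
[cos lam * cis lam * (P z - 1)] with [P] holomorphic, [Re P > 0] and [P 0 = 1]
([robertson_caratheodory]). Along a ray this yields
[d/dr ln |f'| = (cos lam ^ 2 * (Re P - 1) - sin lam * cos lam * Im P) / r].

The two terms behave differently. Harnack's inequality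
[Re P <= (1 + r) / (1 - r)] ([harnack]) shows that the first one contributes at
most [- 2 * cos lam ^ 2 * ln (1 - r)]. The second one can be of the order of
[1 / (1 - r)] pointwise, but its integral over the ray stays bounded
([conjugate_primitive]); this is the boundedness of the argument of the
derivative of the convex function [g] with [1 + z g'' / g' = P]. Hence
[|f' z| <= exp (2 * PI) * (1 - |z|) ^ (- 2 * cos lam ^ 2)]
([robertson_derivative_growth]). The hypothesis says exactly that the exponent
exceeds [-1] (as [cos lam > 0]), so the bound is integrable along rays and [f]
is bounded ([bounded_of_derivative_growth]).

The complex analysis behind these facts is reached directly from the local
power series: termwise differentiation makes [f], [f'], [f''] complex
differentiable ([analytic_derive]), and Cauchy's formula on circles follows by
contracting the circle linearly to a point and differentiating under the
integral sign ([cauchy_circle]). *)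

Notation is_cderive F z l :=
  (@is_derive C_AbsRing C_NormedModule F z l).
Notation is_cseries a l := (@is_series C_AbsRing C_NormedModule a l).
Notation is_cpseries a z l := (@is_pseries C_AbsRing C_NormedModule a z l).

(** * Complex power series and their derivatives *)

Lemma is_cderive_eps (F : C -> C) (z l : C) :
  is_cderive F z l <->
  forall eps : posreal, exists d : posreal, forall w : C,
    Cmod (w - z) < d -> Cmod (F w - F z - (w - z) * l) <= eps * Cmod (w - z).
Proof.
split.
- intros [_ H] eps.
  destruct (H z (fun P HP => HP) eps) as [d Hd].
  exists d. intros w Hw. exact (Hd w Hw).
- intros H. split.
  + exact (@is_linear_scal_l C_AbsRing C_NormedModule l).
  + intros x Hx eps.
    assert (E : z = x) by exact (@is_filter_lim_locally_unique C_AbsRing (AbsRing_NormedModule C_AbsRing) z x Hx).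
    subst x.
    destruct (H eps) as [d Hd]. exists d. intros w Hw. exact (Hd w Hw).
Qed.

(** Trading a factor [|w - z|] for a shift of the radius from [rho] to
[rho + d] avoids any factor [n] in the bound, so that the series estimates
below reduce to a geometric series. *)
Lemma pow_diff_bound (z w : C) (rho d : R) (n : nat) :
  0 < d -> Cmod z <= rho -> Cmod (w - z) <= d ->
  Cmod (w ^ n - z ^ n) <= Cmod (w - z) / d * (rho + d) ^ n.
Proof.
intros Hd Hz Hw. assert (Hrho := Rle_trans _ _ _ (Cmod_ge_0 z) Hz).
assert (H0 := Cmod_ge_0 (w - z)).
assert (Hww : Cmod w <= rho + d).
{ replace w with (z + (w - z))%C by ring.
  eapply Rle_trans; [apply Cmod_triangle|lra]. }
induction n as [|n IH].
- replace (w ^ 0 - z ^ 0)%C with (RtoC 0) by (simpl; ring).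
  rewrite Cmod_0. apply Rmult_le_pos; [apply Rdiv_le_0_compat; lra|apply pow_le; lra].
- rewrite !Cpow_S.
  replace (w * w ^ n - z * z ^ n)%C with (z * (w ^ n - z ^ n) + (w - z) * w ^ n)%C by ring.
  eapply Rle_trans; [apply Cmod_triangle|]. rewrite !Cmod_mult, Cmod_pow.
  apply Rle_trans with (rho * (Cmod (w - z) / d * (rho + d) ^ n) + Cmod (w - z) * (rho + d) ^ n).
  + apply Rplus_le_compat.
    * apply Rmult_le_compat; try apply Cmod_ge_0; assumption.
    * apply Rmult_le_compat_l; [assumption|]. apply pow_incr; split; [apply Cmod_ge_0|assumption].
  + right. simpl. field. lra.
Qed.

(** The second-order version of [pow_diff_bound], obtained from it through
the recursion [E_{n+1} = z E_n + (w - z) (w ^ n - z ^ n)] for the Taylor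
remainders [E_n]. *)
Lemma pow_taylor_bound (z w : C) (rho d : R) (n : nat) :
  0 < d -> Cmod z <= rho -> Cmod (w - z) <= d ->
  Cmod (w ^ S n - z ^ S n - (w - z) * (INR (S n) * z ^ n))
    <= (Cmod (w - z) / d) ^ 2 * (rho + d) ^ S n.
Proof.
intros Hd Hz Hw. assert (Hrho := Rle_trans _ _ _ (Cmod_ge_0 z) Hz).
assert (H0 := Cmod_ge_0 (w - z)).
induction n as [|n IH].
- replace (w ^ 1 - z ^ 1 - (w - z) * (INR 1 * z ^ 0))%C with (RtoC 0) by (simpl; ring).
  rewrite Cmod_0. apply Rmult_le_pos; apply pow_le; [apply Rdiv_le_0_compat; lra|lra].
- replace (w ^ S (S n) - z ^ S (S n) - (w - z) * (INR (S (S n)) * z ^ S n))%C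
    with (z * (w ^ S n - z ^ S n - (w - z) * (INR (S n) * z ^ n))
           + (w - z) * (w ^ S n - z ^ S n))%C
    by (rewrite (S_INR (S n)), RtoC_plus, !Cpow_S; ring).
  eapply Rle_trans; [apply Cmod_triangle|]. rewrite !Cmod_mult.
  apply Rle_trans with (rho * ((Cmod (w - z) / d) ^ 2 * (rho + d) ^ S n)
     + Cmod (w - z) * (Cmod (w - z) / d * (rho + d) ^ S n)).
  + apply Rplus_le_compat.
    * apply Rmult_le_compat; try apply Cmod_ge_0; assumption.
    * apply Rmult_le_compat_l; [assumption|]. now apply pow_diff_bound.
  + right. simpl. field. lra.
Qed.

Lemma pow_n_Cpow (z : C) n : @pow_n C_Ring z n = (z ^ n)%C.
Proof. induction n as [|n IH]; simpl; [reflexivity|]. rewrite IH. reflexivity. Qed.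

Lemma is_cpseriesE (a : nat -> C) (z l : C) :
  is_cpseries a z l <-> is_cseries (fun n => z ^ n * a n)%C l.
Proof.
unfold is_pseries; split; apply is_series_ext; intros n; rewrite <- (pow_n_Cpow z n); reflexivity.
Qed.

Lemma cseries_bounded (a : nat -> C) (l : C) :
  is_cseries a l -> exists M, forall n, Cmod (a n) <= M.
Proof.
intros H.
assert (H' := Cauchy_ex_series (V := C_CompleteNormedModule) a (ex_intro _ l H)).
destruct (H' (mkposreal 1 Rlt_0_1)) as [N HN]. simpl in HN.
assert (B : forall K, exists M, forall n, (n < K)%nat -> Cmod (a n) <= M).
{ induction K as [|K [M HM]].
  - exists 0. intros n Hn; lia.
  - exists (Rmax M (Cmod (a K))). intros n Hn.
    destruct (Nat.eq_dec n K) as [->|E]; [apply Rmax_r|].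
    eapply Rle_trans; [apply HM; lia|apply Rmax_l]. }
destruct (B N) as [M HM]. exists (Rmax M 1). intros n.
destruct (Nat.le_gt_cases N n) as [E|E].
- eapply Rle_trans; [|apply Rmax_r].
  specialize (HN n n E E). rewrite sum_n_n in HN. now apply Rlt_le.
- eapply Rle_trans; [apply HM; lia|apply Rmax_l].
Qed.

Lemma cseries_le (a : nat -> C) (b : nat -> R) (l : C) (m : R) :
  is_cseries a l -> is_series b m -> (forall n, Cmod (a n) <= b n) -> Cmod l <= m.
Proof.
intros Ha Hb Hab.
assert (H := filterlim_norm (K := C_AbsRing) (V := C_NormedModule) l).
assert (H1 : is_lim_seq (fun n => Cmod (@sum_n C_AbelianMonoid a n)) (Cmod l)).
{ exact (filterlim_comp _ _ _ _ _ _ _ _ Ha H). }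
assert (H2 : is_lim_seq (sum_n b) m) by exact Hb.
apply (is_lim_seq_le _ _ (Finite (Cmod l)) (Finite m)) with (3 := H2) (2 := H1).
intros n. induction n as [|n IH].
- rewrite !sum_O. apply Hab.
- rewrite !sum_Sn. eapply Rle_trans; [apply Cmod_triangle|].
  now apply Rplus_le_compat.
Qed.

Lemma half_geom_series (M : R) : is_series (fun n => M * (1/2) ^ n) (M * 2).
Proof.
replace (M * 2) with (M * / (1 - 1/2)) by field.
apply (is_series_scal (K := R_AbsRing) (V := R_NormedModule) M).
apply is_series_geom. rewrite Rabs_pos_eq; lra.
Qed.

Lemma half_geom_series_tail (M : R) : is_series (fun n => M * (1/2) ^ S n) M.
Proof.
apply (is_series_incr_1 (fun n => M * (1/2)^n)).
replace (plus _ _) with (M * 2); [apply half_geom_series|].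
unfold plus; simpl. ring.
Qed.

(** The terms of the series at a point of modulus [r / 2] are bounded, which
gives geometric decay at half that radius, written [rho + rho] to match the
enlarged radius of [pow_taylor_bound]. *)
Lemma pseries_coef_bound (a : nat -> C) (r : R) (g : C -> C) :
  0 < r -> (forall u, Cmod u < r -> is_cpseries a u (g u)) ->
  exists rho M, 0 < rho /\ rho + rho <= r /\ 0 <= M /\
    forall n, Cmod (a n) * (rho + rho) ^ n <= M * (1/2) ^ n.
Proof.
intros Hr Ha.
set (s := r / 2). assert (Hs : 0 < s) by (unfold s; lra).
assert (E : Cmod s < r) by (rewrite Cmod_R, Rabs_pos_eq; unfold s; lra).
specialize (Ha _ E). apply is_cpseriesE, cseries_bounded in Ha.
destruct Ha as [M HM].
assert (HM' : forall n, Cmod (a n) * s ^ n <= M).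
{ intros n. specialize (HM n).
  rewrite Cmod_mult, Cmod_pow, Cmod_R, Rabs_pos_eq in HM by lra. lra. }
exists (s / 4), M. repeat split.
- lra.
- unfold s. lra.
- eapply Rle_trans; [apply Cmod_ge_0|apply (HM 0%nat)].
- intros n. replace (s / 4 + s / 4) with (s * (1/2)) by field.
  rewrite Rpow_mult_distr, <- Rmult_assoc.
  apply Rmult_le_compat_r; [apply pow_le; lra|apply HM'].
Qed.

Lemma INR_mult_pow_le (rho : R) (n : nat) :
  0 < rho -> INR n * rho ^ n <= (rho + rho) ^ n.
Proof.
intros Hr. replace (rho + rho) with (rho * (1 + 1)) by ring.
rewrite Rpow_mult_distr, (Rmult_comm (INR _)).
apply Rmult_le_compat_l; [apply pow_le; lra|].
apply Rlt_le. change (1 + 1) with 2.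
induction n as [|n IH]; [simpl; lra|]. rewrite S_INR. simpl pow.
assert (1 <= 2 ^ n) by (apply pow_R1_Rle; lra). lra.
Qed.

(** Termwise differentiation: the Taylor remainders of the monomials sum to
at most [M * (|v - u| / rho) ^ 2], which is quadratic in the increment. *)
Lemma pseries_derive (a : nat -> C) (rho M : R) (g : C -> C) (u : C) :
  0 < rho -> 0 <= M ->
  (forall n, Cmod (a n) * (rho + rho) ^ n <= M * (1/2) ^ n) ->
  (forall v, Cmod v < rho -> is_cpseries a v (g v)) -> Cmod u < rho ->
  exists l, is_cpseries (fun n => INR (S n) * a (S n))%C u l /\ is_cderive g u l.
Proof.
intros Hrho HM0 HM Ha Hu.
assert (Hb : forall n, Cmod (u ^ n * (INR (S n) * a (S n))) <= / rho * (M * (1/2) ^ S n)).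
{ intros n. rewrite !Cmod_mult, Cmod_pow, Cmod_R, Rabs_pos_eq by apply pos_INR.
  apply Rle_trans with (/ rho * (Cmod (a (S n)) * (INR (S n) * rho ^ S n))).
  - apply Rle_trans with (rho ^ n * (INR (S n) * Cmod (a (S n)))).
    + apply Rmult_le_compat_r.
      * apply Rmult_le_pos; [apply pos_INR|apply Cmod_ge_0].
      * apply pow_incr; split; [apply Cmod_ge_0|lra].
    + right. simpl pow. field. lra.
  - apply Rmult_le_compat_l; [left; now apply Rinv_0_lt_compat|].
    eapply Rle_trans; [|apply HM].
    apply Rmult_le_compat_l; [apply Cmod_ge_0|now apply INR_mult_pow_le]. }
assert (Hex : exists l, is_cseries (fun n => u ^ n * (INR (S n) * a (S n)))%C l).
{ apply (ex_series_le (V := C_CompleteNormedModule)) with (1 := Hb).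
  apply (ex_series_scal (K := R_AbsRing) (V := R_NormedModule)).
  exists M. apply half_geom_series_tail. }
destruct Hex as [l Hl]. exists l. split; [now apply is_cpseriesE|].
apply is_cderive_eps. intros eps.
set (Q := M / rho ^ 2).
assert (HQ : 0 <= Q) by (apply Rdiv_le_0_compat; [lra|apply pow_lt; lra]).
assert (Hd : 0 < Rmin (rho - Cmod u) (eps / (Q + 1))).
{ apply Rmin_pos; [lra|]. apply Rdiv_lt_0_compat; [apply cond_pos|lra]. }
exists (mkposreal _ Hd). simpl. intros v Hv.
assert (Hv1 := Rlt_le_trans _ _ _ Hv (Rmin_l _ _)).
assert (Hv2 := Rlt_le_trans _ _ _ Hv (Rmin_r _ _)).
assert (Hh := Cmod_ge_0 (v - u)).
assert (Hvr : Cmod v < rho).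
{ replace v with (u + (v - u))%C by ring.
  eapply Rle_lt_trans; [apply Cmod_triangle|lra]. }
assert (S1 : is_cseries (fun n => v ^ n * a n - u ^ n * a n)%C (g v - g u)%C).
{ assert (Sv := proj1 (is_cpseriesE _ _ _) (Ha v Hvr)).
  assert (Su := proj1 (is_cpseriesE _ _ _) (Ha u Hu)).
  exact (is_series_minus _ _ _ _ Sv Su). }
assert (S2 : is_cseries (fun n => v ^ S n * a (S n) - u ^ S n * a (S n))%C (g v - g u)%C).
{ apply (is_series_incr_1 (fun n => v ^ n * a n - u ^ n * a n)%C).
  replace (plus _ _) with (g v - g u)%C; [exact S1|].
  simpl. change (plus ?x ?y) with (Cplus x y). ring. }
assert (S3 : is_cseries (fun n => (v ^ S n * a (S n) - u ^ S n * a (S n))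
     - (v - u) * (u ^ n * (INR (S n) * a (S n))))%C (g v - g u - (v - u) * l)%C).
{ apply (is_series_minus _ _ _ _ S2). exact (is_series_scal (v - u)%C _ _ Hl). }
assert (S4 : is_series (fun n => (Cmod (v - u) / rho) ^ 2 * (M * (1 / 2) ^ S n))
          ((Cmod (v - u) / rho) ^ 2 * M)).
{ apply (is_series_scal (K := R_AbsRing) (V := R_NormedModule)).
  apply half_geom_series_tail. }
apply Rle_trans with ((Cmod (v - u) / rho) ^ 2 * M).
- apply (cseries_le _ _ _ _ S3 S4). intros n.
  replace (_ - _)%C with ((v ^ S n - u ^ S n - (v - u) * (INR (S n) * u ^ n)) * a (S n))%C
    by ring.
  rewrite Cmod_mult.
  apply Rle_trans with ((Cmod (v - u) / rho) ^ 2 * (rho + rho) ^ S n * Cmod (a (S n))).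
  + apply Rmult_le_compat_r; [apply Cmod_ge_0|].
    apply pow_taylor_bound; [lra|lra|]. assert (X := Cmod_ge_0 u). lra.
  + rewrite Rmult_assoc. apply Rmult_le_compat_l; [apply pow2_ge_0|].
    rewrite Rmult_comm. apply HM.
- replace ((Cmod (v - u) / rho) ^ 2 * M) with (Cmod (v - u) * Q * Cmod (v - u))
    by (unfold Q; field; lra).
  apply Rmult_le_compat_r; [assumption|].
  apply Rle_trans with (Cmod (v - u) * (Q + 1)); [apply Rmult_le_compat_l; lra|].
  apply Rmult_lt_compat_r with (r := Q + 1) in Hv2; [|lra].
  replace (eps / (Q + 1) * (Q + 1)) with (pos eps) in Hv2 by (field; lra). lra.
Qed.

Lemma is_cderive_shift (f : C -> C) (z0 z l : C) :
  is_cderive (fun u => f (z0 + u))%C (z - z0)%C l -> is_cderive f z l.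
Proof.
intros H. apply is_cderive_eps. intros eps.
destruct (proj1 (is_cderive_eps _ _ _) H eps) as [d Hd]. exists d. intros w Hw.
specialize (Hd (w - z0)%C). simpl in Hd.
replace (w - z0 - (z - z0))%C with (w - z)%C in Hd by ring.
replace (z0 + (w - z0))%C with w in Hd by ring.
replace (z0 + (z - z0))%C with z in Hd by ring. auto.
Qed.

(** The derived series converges near the same centre, so the derivative is
again analytic and the statement can be iterated. *)
Lemma analytic_derive (D : C -> Prop) (f : C -> C) :
  analytic_on D f ->
  (forall z, D z -> is_cderive f z (C_derive f z)) /\ analytic_on D (C_derive f).
Proof.
intros Hf.
assert (K : forall z0, D z0 -> exists (b : nat -> C) (r : R), 0 < r /\
   forall z, Cmod (z - z0) < r -> exists l,
     is_cpseries b (z - z0)%C l /\ is_cderive f z l).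
{ intros z0 Hz0. destruct (Hf z0 Hz0) as (a & r & Hr & Ha).
  assert (Ha' : forall u, Cmod u < r -> is_cpseries a u (f (z0 + u)%C)).
  { intros u Hu. specialize (Ha (z0 + u)%C).
    replace (z0 + u - z0)%C with u in Ha by ring. auto. }
  destruct (pseries_coef_bound a r _ Hr Ha') as (rho & M & Hrho & Hle & HM0 & HM).
  exists (fun n => INR (S n) * a (S n))%C, rho. split; [assumption|]. intros z Hz.
  destruct (pseries_derive a rho M (fun u => f (z0 + u)%C) (z - z0)%C) as (l & Hl & Hd);
    try assumption.
  { intros v Hv. apply Ha'. lra. }
  exists l. split; [assumption|]. now apply is_cderive_shift with z0. }
split.
- intros z Hz. destruct (K z Hz) as (b & r & Hr & Hb).
  destruct (Hb z) as (l & _ & Hl).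
  { replace (z - z)%C with (RtoC 0) by ring. now rewrite Cmod_0. }
  apply (C_derive_correct f z 0). now exists l.
- intros z0 Hz0. destruct (K z0 Hz0) as (b & r & Hr & Hb).
  exists b, r. split; [assumption|]. intros z Hz.
  destruct (Hb z Hz) as (l & Hs & Hl). now rewrite (is_C_derive_unique f z l Hl).
Qed.

(** * Complex differentiation and integrals with a parameter *)

(** [is_derive_mult] and [is_derive_comp] speak of the normed module that an
absolute ring forms over itself; on [C] its neighbourhoods are
Euclidean disks, while those of [C_NormedModule] are squares. The two notions
of derivative agree because only the norm enters. *)
Lemma is_cderive_absring (F : C -> C) (z l : C) :
  is_cderive F z l <-> @is_derive C_AbsRing (AbsRing_NormedModule C_AbsRing) F z l.
Proof.
split; intros [_ H]; (split; [|exact H]).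
- exact (@is_linear_scal_l C_AbsRing (AbsRing_NormedModule C_AbsRing) l).
- exact (@is_linear_scal_l C_AbsRing C_NormedModule l).
Qed.

Lemma is_cderive_ext_val (F : C -> C) (z l l' : C) :
  l = l' -> is_cderive F z l -> is_cderive F z l'.
Proof. now intros ->. Qed.

Lemma is_cderive_mult (F G : C -> C) (z lF lG : C) :
  is_cderive F z lF -> is_cderive G z lG ->
  is_cderive (fun w => F w * G w)%C z (lF * G z + F z * lG)%C.
Proof.
intros HF HG. apply is_cderive_absring.
apply is_cderive_absring in HF, HG.
exact (is_derive_mult F G z lF lG HF HG Cmult_comm).
Qed.

Lemma is_cderive_comp (F G : C -> C) (z lF lG : C) :
  is_cderive F (G z) lF -> is_cderive G z lG ->
  is_cderive (fun w => F (G w)) z (lG * lF)%C.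
Proof.
intros HF HG. apply is_cderive_absring in HG.
exact (@is_derive_comp C_AbsRing C_NormedModule F G z lF lG HF HG).
Qed.

Lemma is_cderive_plus (F G : C -> C) (z lF lG : C) :
  is_cderive F z lF -> is_cderive G z lG ->
  is_cderive (fun w => F w + G w)%C z (lF + lG)%C.
Proof. exact (@is_derive_plus C_AbsRing C_NormedModule F G z lF lG). Qed.

Lemma is_cderive_id (z : C) : is_cderive (fun w => w) z (RtoC 1).
Proof. apply is_cderive_absring. exact (@is_derive_id C_AbsRing z). Qed.

Lemma is_cderive_const (c z : C) : is_cderive (fun _ => c) z (RtoC 0).
Proof. exact (@is_derive_const C_AbsRing C_NormedModule c z). Qed.

Lemma is_cderive_inv (z : C) : z <> 0 -> is_cderive Cinv z (- / (z * z))%C.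
Proof.
intros Hz. assert (Hz' := proj1 (Cmod_gt_0 z) Hz).
apply is_cderive_eps. intros eps.
set (m := Cmod z) in *.
assert (Hd : 0 < Rmin (m / 2) (eps * (m * m * m / 2))).
{ assert (X := cond_pos eps). apply Rmin_pos; [lra|].
  apply Rmult_lt_0_compat; [lra|]. assert (0 < m * m) by nra. nra. }
exists (mkposreal _ Hd). simpl. intros w Hw.
assert (Hw1 := Rlt_le_trans _ _ _ Hw (Rmin_l _ _)).
assert (Hw2 := Rlt_le_trans _ _ _ Hw (Rmin_r _ _)).
assert (Hwm : m / 2 <= Cmod w).
{ assert (X : m <= Cmod w + Cmod (w - z)).
  { unfold m. replace z with (w + - (w - z))%C by ring.
    eapply Rle_trans; [apply Cmod_triangle|]. rewrite Cmod_opp.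
    replace (w + - (w - z) )%C with z by ring. lra. }
  lra. }
assert (Hw0 : w <> 0) by (apply Cmod_gt_0; lra).
replace (/ w - / z - (w - z) * - / (z * z))%C
  with ((w - z) * ((w - z) / (w * (z * z))))%C by (field; auto).
assert (Hwzz : (w * (z * z))%C <> 0) by now repeat apply Cmult_neq_0.
rewrite Cmod_mult, Cmod_div, !Cmod_mult by assumption. fold m.
rewrite Rmult_comm. apply Rmult_le_compat_r; [apply Cmod_ge_0|].
assert (Hp : 0 < Cmod w * (m * m)) by (apply Rmult_lt_0_compat; nra).
apply Rle_div_l; [assumption|].
apply Rle_trans with (eps * (m * m * m / 2)); [lra|].
apply Rmult_le_compat_l; [apply Rlt_le, cond_pos|]. nra.
Qed.

Lemma continuous_C_components {U : UniformSpace} (f : U -> C) (x : U) :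
  continuous (fun u => Re (f u)) x -> continuous (fun u => Im (f u)) x ->
  continuous f x.
Proof.
intros H1 H2 P [e HP]. change (locally x (fun u => P (f u))).
destruct (H1 _ (locally_ball (Re (f x)) e)) as [d1 B1].
destruct (H2 _ (locally_ball (Im (f x)) e)) as [d2 B2].
exists (mkposreal _ (Rmin_stable_in_posreal d1 d2)). intros u Hu. apply HP. split.
- apply B1. exact (ball_le _ _ _ (Rmin_l _ _) _ Hu).
- apply B2. exact (ball_le _ _ _ (Rmin_r _ _) _ Hu).
Qed.

Lemma continuous_Re (z : C) : continuous Re z.
Proof. destruct z as [x y]. exact (continuous_fst x y). Qed.

Lemma continuous_Im (z : C) : continuous Im z.
Proof. destruct z as [x y]. exact (continuous_snd x y). Qed.

Lemma continuous_Re_comp {U : UniformSpace} (f : U -> C) (x : U) : continuous f x -> continuous (fun u => Re (f u)) x.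
Proof. intros H. apply continuous_comp; [exact H|apply continuous_Re]. Qed.

Lemma continuous_Im_comp {U : UniformSpace} (f : U -> C) (x : U) : continuous f x -> continuous (fun u => Im (f u)) x.
Proof. intros H. apply continuous_comp; [exact H|apply continuous_Im]. Qed.

Lemma continuous_Cplus {U : UniformSpace} (f g : U -> C) (x : U) :
  continuous f x -> continuous g x -> continuous (fun u => f u + g u)%C x.
Proof.
intros Hf Hg. apply continuous_C_components; simpl.
- apply (continuous_plus (K := R_AbsRing) (V := R_NormedModule)
    (fun u => Re (f u)) (fun u => Re (g u))); now apply continuous_Re_comp.
- apply (continuous_plus (K := R_AbsRing) (V := R_NormedModule)
    (fun u => Im (f u)) (fun u => Im (g u))); now apply continuous_Im_comp.
Qed.

Lemma continuous_Cmult {U : UniformSpace} (f g : U -> C) (x : U) :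
  continuous f x -> continuous g x -> continuous (fun u => f u * g u)%C x.
Proof.
intros Hf Hg.
assert (Rf := continuous_Re_comp _ _ Hf). assert (If := continuous_Im_comp _ _ Hf).
assert (Rg := continuous_Re_comp _ _ Hg). assert (Ig := continuous_Im_comp _ _ Hg).
apply continuous_C_components; simpl.
- apply (continuous_minus (K := R_AbsRing) (V := R_NormedModule));
    now apply (continuous_mult (K := R_AbsRing)).
- apply (continuous_plus (K := R_AbsRing) (V := R_NormedModule));
    now apply (continuous_mult (K := R_AbsRing)).
Qed.

Lemma is_cderive_continuous (F : C -> C) (z l : C) : is_cderive F z l -> continuous F z.
Proof.
intros H.
assert (X := ex_derive_continuous (K := C_AbsRing) (V := C_NormedModule) F z (ex_intro _ l H)).
intros P HP. apply locally_C. exact (X P HP).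
Qed.

(** The derivative is carried as data, so that closure lemmas compute it; its
continuity is what differentiation under the integral sign asks for. *)
Definition holo (F F' : C -> C) : Prop :=
  forall z, unit_disk z -> is_cderive F z (F' z) /\ continuous F' z.

Lemma holo_scal F F' c :
  holo F F' -> holo (fun z => c * F z)%C (fun z => c * F' z)%C.
Proof.
intros HF z Hz. destruct (HF z Hz) as [F1 F2]. split.
- apply is_cderive_ext_val with (0 * F z + c * F' z)%C; [ring|].
  apply (is_cderive_mult (fun _ => c)); [apply is_cderive_const|assumption].
- apply continuous_Cmult; [apply continuous_const|assumption].
Qed.

Lemma holo_mult F F' G G' :
  holo F F' -> holo G G' ->
  holo (fun z => F z * G z)%C (fun z => F' z * G z + F z * G' z)%C.
Proof.
intros HF HG z Hz. destruct (HF z Hz) as [F1 F2], (HG z Hz) as [G1 G2]. split.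
- now apply is_cderive_mult.
- apply continuous_Cplus; apply continuous_Cmult; auto; eapply is_cderive_continuous; eauto.
Qed.

Lemma holo_plus F F' G G' :
  holo F F' -> holo G G' ->
  holo (fun z => F z + G z)%C (fun z => F' z + G' z)%C.
Proof.
intros HF HG z Hz. destruct (HF z Hz) as [F1 F2], (HG z Hz) as [G1 G2]. split.
- now apply is_cderive_plus.
- now apply continuous_Cplus.
Qed.

Lemma holo_const c : holo (fun _ => c) (fun _ => 0).
Proof. intros z _. split; [apply is_cderive_const|apply continuous_const]. Qed.

Lemma holo_id : holo (fun z => z) (fun _ => 1).
Proof. intros z _. split; [apply is_cderive_id|apply continuous_const]. Qed.

Lemma holo_inv F F' :
  holo F F' -> (forall z, unit_disk z -> F z <> 0) ->
  holo (fun z => / F z)%C (fun z => F' z * - (/ (F z * F z)))%C.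
Proof.
intros HF H0 z Hz. destruct (HF z Hz) as [F1 F2]. specialize (H0 z Hz). split.
- apply (is_cderive_comp Cinv F); [now apply is_cderive_inv|assumption].
- apply continuous_Cmult; [assumption|].
  apply (continuous_comp (fun z => F z * F z)%C (fun w => - / w)%C).
  + apply continuous_Cmult; eapply is_cderive_continuous; eauto.
  + apply (is_cderive_continuous (fun w => - / w)%C) with (l := (- (- / ((F z * F z) * (F z * F z))))%C).
    apply (@is_derive_opp C_AbsRing C_NormedModule Cinv).
    apply is_cderive_inv. now apply Cmult_neq_0.
Qed.

Lemma holo_scale F F' c :
  Cmod c <= 1 -> holo F F' -> holo (fun z => F (c * z))%C (fun z => c * F' (c * z))%C.
Proof.
intros Hc HF z Hz.
assert (Hcz : unit_disk (c * z)%C).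
{ unfold unit_disk in *. rewrite Cmod_mult.
  apply Rle_lt_trans with (1 * Cmod z); [|lra].
  apply Rmult_le_compat_r; [apply Cmod_ge_0|assumption]. }
assert (Hlin : is_cderive (fun w => c * w)%C z c).
{ apply is_cderive_ext_val with (0 * z + c * 1)%C; [ring|].
  apply (is_cderive_mult (fun _ => c) (fun w => w)); [apply is_cderive_const|apply is_cderive_id]. }
destruct (HF _ Hcz) as [F1 F2]. split.
- now apply (is_cderive_comp F (fun w => c * w)%C).
- apply continuous_Cmult; [apply continuous_const|].
  apply (continuous_comp (fun w => c * w)%C F'); [eapply is_cderive_continuous; eauto|assumption].
Qed.

Definition is_curve_derive (g : R -> C) (t : R) (v : C) : Prop :=
  is_derive (fun u => Re (g u)) t (Re v) /\ is_derive (fun u => Im (g u)) t (Im v).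

(** The factor [k] selects a real-linear functional of the value: [k = 1]
gives the real part and [k = - Ci] the imaginary part. *)
Lemma differentiable_Re_mult (F : C -> C) (z l k : C) :
  is_cderive F z l ->
  differentiable_pt_lim (fun x y => Re (F (x, y) * k)%C) (Re z) (Im z)
    (Re (l * k)) (Re (Ci * l * k)).
Proof.
intros HF eps.
assert (Hpos : 0 < eps / (2 * (Cmod k + 1))).
{ assert (X := cond_pos eps). assert (Y := Cmod_ge_0 k).
  apply Rdiv_lt_0_compat; lra. }
destruct (proj1 (is_cderive_eps F z l) HF (mkposreal _ Hpos)) as [d Hd]. simpl in Hd.
assert (Hd2 : 0 < d / 2) by (assert (X := cond_pos d); lra).
exists (mkposreal _ Hd2). intros u v Hu Hv. cbn [pos] in Hu, Hv.
set (w := (u, v) : C).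
assert (Hsqrt : sqrt 2 <= 2).
{ rewrite <- (sqrt_Rsqr 2) at 2 by lra. apply sqrt_le_1_alt. unfold Rsqr; lra. }
assert (Hm0 : 0 <= Rmax (Rabs (u - Re z)) (Rabs (v - Im z))).
{ eapply Rle_trans; [apply Rabs_pos|apply Rmax_l]. }
assert (Hm : Cmod (w - z) <= 2 * Rmax (Rabs (u - Re z)) (Rabs (v - Im z))).
{ eapply Rle_trans; [apply Cmod_2Rmax|]. simpl.
  apply Rmult_le_compat_r; assumption. }
assert (Hw : Cmod (w - z) < d).
{ eapply Rle_lt_trans; [exact Hm|].
  assert (X := Rmax_lub_lt _ _ _ Hu Hv). lra. }
specialize (Hd w Hw).
replace (Re (F w * k) - Re (F (Re z, Im z) * k)
   - (Re (l * k) * (u - Re z) + Re (Ci * l * k) * (v - Im z)))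
  with (Re ((F w - F z - (w - z) * l) * k)).
2:{ destruct z as [x y]. unfold w. simpl. ring. }
eapply Rle_trans; [apply re_le_Cmod|]. rewrite Cmod_mult.
apply Rle_trans with (eps / (2 * (Cmod k + 1)) * Cmod (w - z) * Cmod k).
{ apply Rmult_le_compat_r; [apply Cmod_ge_0|assumption]. }
assert (Y := Cmod_ge_0 k).
apply Rle_trans with (eps / (2 * (Cmod k + 1)) * (2 * Rmax (Rabs (u - Re z)) (Rabs (v - Im z))) * (Cmod k + 1)).
{ apply Rmult_le_compat; [|assumption| |lra].
  - apply Rmult_le_pos; [lra|apply Cmod_ge_0].
  - apply Rmult_le_compat_l; [lra|assumption]. }
right. field. lra.
Qed.

Lemma is_derive_Re_comp (F : C -> C) (g : R -> C) (t : R) (v l k : C) :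
  is_cderive F (g t) l -> is_curve_derive g t v ->
  is_derive (fun u => Re (F (g u) * k)%C) t (Re (v * l * k)).
Proof.
intros HF [H1 H2].
replace (Re (v * l * k)) with (Re (l * k) * Re v + Re (Ci * l * k) * Im v)
  by (destruct v; simpl; ring).
apply is_derive_Reals.
apply is_derive_Reals in H1, H2.
assert (X := derivable_pt_lim_comp_2d _ _ _ _ _ _ _ _
  (differentiable_Re_mult F (g t) l k HF) H1 H2).
apply is_derive_Reals in X. apply is_derive_Reals.
revert X. apply is_derive_ext. intros u. now destruct (g u).
Qed.

(** Differentiation under the integral sign along a family of curves
[a + s * m t] depending affinely on the parameter. The curves stay in the disk
for all real [t], not only on [[b, c]], because continuity in two variables is
needed on full neighbourhoods of the endpoints. *)
Lemma RInt_param_derive (F F' : C -> C) (m K : R -> C) (a : C) (b c tau : R) :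
  holo F F' -> (forall t, continuous m t) -> (forall t, continuous K t) ->
  locally tau (fun s : R => forall t, unit_disk (a + s * m t)%C) ->
  is_derive (fun s : R => RInt (fun t => Re (F (a + s * m t) * K t)%C) b c) tau
    (RInt (fun t => Re (F' (a + tau * m t) * m t * K t)%C) b c).
Proof.
intros HF Hm HK HD.
assert (D : forall s t : R, unit_disk (a + s * m t)%C ->
  is_derive (fun s : R => Re (F (a + s * m t) * K t)%C) s (Re (F' (a + s * m t) * m t * K t)%C)).
{ intros s t Hst.
  replace (F' (a + s * m t) * m t * K t)%C with (m t * F' (a + s * m t) * K t)%C by ring.
  apply (is_derive_Re_comp F (fun s : R => a + s * m t)%C); [now apply HF|].
  split; unfold Re, Im; simpl; auto_derive; auto; ring. }
assert (Cp : forall s t : R, continuous (fun p : R * R => a + fst p * m (snd p))%C (s, t)).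
{ intros s t. apply continuous_Cplus; [apply continuous_const|].
  apply continuous_Cmult.
  - apply continuous_C_components; simpl; [apply continuous_fst|apply continuous_const].
  - apply (continuous_comp snd m); [apply continuous_snd|apply Hm]. }
assert (Cs : forall (G : C -> C) (s t : R), continuous G (a + s * m t)%C ->
  continuous (fun t => G (a + s * m t)%C) t).
{ intros G s t HG. apply (continuous_comp (fun t => a + s * m t)%C G); [|exact HG].
  apply continuous_Cplus; [apply continuous_const|].
  apply continuous_Cmult; [apply continuous_const|apply Hm]. }
assert (E : RInt (fun t => Re (F' (a + tau * m t) * m t * K t)%C) b c =
  RInt (fun t => Derive (fun u : R => Re (F (a + u * m t) * K t)%C) tau) b c).
{ apply RInt_ext. intros t _. symmetry. apply is_derive_unique, D.
  exact (locally_singleton _ _ HD t). }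
rewrite E.
apply (is_derive_RInt_param (fun s t : R => Re (F (a + s * m t) * K t)%C)).
- revert HD. apply filter_imp. intros s Hs t _. eexists. apply D, Hs.
- intros t _.
  apply continuity_2d_pt_ext_loc with (fun s t : R => Re (F' (a + s * m t) * m t * K t)%C).
  + destruct HD as [e He]. exists e. intros u v Hu _. symmetry. apply is_derive_unique, D.
    apply He. exact Hu.
  + apply continuity_2d_pt_filterlim.
    enough (X : continuous (fun p : R * R =>
      (F' (a + fst p * m (snd p)) * m (snd p) * K (snd p))%C) (tau, t))
      by exact (continuous_Re_comp _ _ X).
    apply continuous_Cmult; [apply continuous_Cmult|].
    * apply (continuous_comp (fun p : R * R => a + fst p * m (snd p))%C F'); [apply Cp|].
      apply HF. exact (locally_singleton _ _ HD t).
    * apply (continuous_comp snd m); [apply continuous_snd|apply Hm].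
    * apply (continuous_comp snd K); [apply continuous_snd|apply HK].
- revert HD. apply filter_imp. intros s Hs.
  apply (ex_RInt_continuous (V := R_CompleteNormedModule)). intros t _.
  apply continuous_Re_comp, continuous_Cmult; [|apply HK].
  apply Cs. eapply is_cderive_continuous. apply HF, Hs.
Qed.

(** * Cauchy's formula on circles *)

Lemma Ci_neq_0 : Ci <> 0.
Proof. intros E. apply (f_equal snd) in E. simpl in E. lra. Qed.

Lemma Cmod_cis (t : R) : Cmod (cis t) = 1.
Proof.
unfold Cmod, cis; simpl. rewrite !Rmult_1_r, Rplus_comm.
change (sqrt ((sin t)² + (cos t)²) = 1). now rewrite sin2_cos2, sqrt_1.
Qed.

Lemma cis_neq_0 (t : R) : cis t <> 0.
Proof. apply Cmod_gt_0. rewrite Cmod_cis. lra. Qed.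

Lemma cis_conj (t : R) : (cis t * Cconj (cis t))%C = 1.
Proof. rewrite <- Cmod2_conj, Cmod_cis. f_equal. ring. Qed.

Lemma continuous_cis (t : R) : continuous cis t.
Proof.
apply continuous_C_components; simpl.
- apply continuous_cos.
- apply continuous_sin.
Qed.

Lemma is_curve_derive_circle (a b : C) (t : R) :
  is_curve_derive (fun t => a + b * cis t)%C t (b * (Ci * cis t))%C.
Proof. split; unfold Re, Im; simpl; auto_derive; auto; ring. Qed.

Lemma Cmod_circle (rho t : R) : 0 <= rho -> Cmod (rho * cis t) = rho.
Proof. intros H. rewrite Cmod_mult, Cmod_cis, Cmod_R, Rabs_pos_eq; lra. Qed.

Lemma circle_minus_neq_0 (a : C) (rho t : R) : Cmod a < rho -> (rho * cis t - a)%C <> 0.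
Proof.
intros Ha E. assert (X : (rho * cis t)%C = a).
{ replace a with (rho * cis t - (rho * cis t - a))%C by ring. rewrite E. ring. }
assert (Hrho : 0 <= rho) by (assert (Y := Cmod_ge_0 a); lra).
rewrite <- X, Cmod_circle in Ha; lra.
Qed.

Lemma continuous_circle (F : C -> C) (a b : C) (t : R) :
  continuous F (a + b * cis t)%C -> continuous (fun t => F (a + b * cis t)%C) t.
Proof.
intros HF. apply (continuous_comp (fun t => a + b * cis t)%C F); [|exact HF].
apply continuous_Cplus; [apply continuous_const|].
apply continuous_Cmult; [apply continuous_const|apply continuous_cis].
Qed.

Lemma holo_continuous F F' z : holo F F' -> unit_disk z -> continuous F z.
Proof. intros HF Hz. eapply is_cderive_continuous. now apply HF. Qed.

Lemma cis_2PI : cis (2 * PI) = 1.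
Proof. unfold cis. now rewrite cos_2PI, sin_2PI. Qed.

Lemma cis_0 : cis 0 = 1.
Proof. unfold cis. now rewrite cos_0, sin_0. Qed.

(** Up to a constant factor the integrand is the derivative in [t] of
[F (a + b * cis t)], which takes the same value at both ends. *)
Lemma RInt_circle_derivative (F F' : C -> C) (a b : C) :
  holo F F' -> b <> 0 -> (forall t, unit_disk (a + b * cis t)%C) ->
  RInt (fun t => Re (F' (a + b * cis t) * cis t)%C) 0 (2 * PI) = 0.
Proof.
intros HF Hb HD.
set (G := fun t => Re (F (a + b * cis t) * / (b * Ci))%C).
assert (HCi := Ci_neq_0).
replace 0 with (minus (G (2 * PI)) (G 0)) at 2.
2:{ unfold G. rewrite cis_2PI, cis_0. unfold minus, plus, opp; simpl. ring. }
apply is_RInt_unique.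
apply (is_RInt_derive (V := R_CompleteNormedModule) G); intros t _.
- replace (F' (a + b * cis t) * cis t)%C
    with ((b * (Ci * cis t)) * F' (a + b * cis t) * / (b * Ci))%C by (field; auto).
  apply (is_derive_Re_comp F (fun t => a + b * cis t)%C).
  + now apply HF.
  + apply is_curve_derive_circle.
- apply continuous_Re_comp, continuous_Cmult; [|apply continuous_cis].
  apply continuous_circle. now apply HF.
Qed.

(** Cauchy's integral formula, in the form that freezes [F] at [a] instead of
evaluating the remaining integral: shrink the circle linearly onto [a]. The
parameter derivative of the integral is the integral of
[F' (a + s * m t) * rho * cis t], since the factor [m t] cancels the
denominator of the kernel, and it vanishes by [RInt_circle_derivative]. *)
Lemma cauchy_circle (F F' : C -> C) (a : C) (rho : R) :
  holo F F' -> Cmod a < rho -> rho < 1 ->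
  let K t := (rho * cis t / (rho * cis t - a))%C in
  RInt (fun t => Re (F (rho * cis t) * K t)%C) 0 (2 * PI) =
  RInt (fun t => Re (F a * K t)%C) 0 (2 * PI).
Proof.
intros HF Ha Hrho K. assert (Ha0 := Cmod_ge_0 a).
set (m := fun t => (rho * cis t - a)%C).
assert (Hm0 : forall t, m t <> 0) by (intros t; now apply circle_minus_neq_0).
assert (Hm : forall t, continuous m t).
{ intros t. apply continuous_Cplus; [|apply continuous_const].
  apply continuous_Cmult; [apply continuous_const|apply continuous_cis]. }
assert (HK : forall t, continuous K t).
{ intros t. apply continuous_Cmult.
  - apply continuous_Cmult; [apply continuous_const|apply continuous_cis].
  - apply (continuous_comp m Cinv); [apply Hm|].
    eapply is_cderive_continuous. now apply is_cderive_inv. }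
set (Phi := fun s : R => RInt (fun t => Re (F (a + s * m t) * K t)%C) 0 (2 * PI)).
assert (HD : forall s, 0 <= s <= 1 -> locally s (fun u : R => forall t, unit_disk (a + u * m t)%C)).
{ intros s Hs. assert (He : 0 < (1 - rho) / 4) by lra.
  exists (mkposreal _ He). intros u Hu t.
  assert (Hu' : Rabs (u - s) < (1 - rho) / 4) by exact Hu.
  unfold unit_disk, m.
  replace (a + u * (rho * cis t - a))%C
    with ((1 - s)%R * a + s * (rho * cis t) + (u - s)%R * (rho * cis t - a))%C
    by (rewrite !RtoC_minus; ring).
  eapply Rle_lt_trans; [apply Cmod_triangle|].
  apply Rle_lt_trans with (rho + (1 - rho) / 4 * 2); [|lra].
  assert (A1 : Cmod ((1 - s)%R * a + s * (rho * cis t)) <= rho).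
  { eapply Rle_trans; [apply Cmod_triangle|].
    rewrite (Cmod_mult (1 - s)%R), (Cmod_mult s), !Cmod_R, Cmod_circle, !Rabs_pos_eq by lra. nra. }
  assert (A2 : Cmod (rho * cis t - a) <= 2).
  { eapply Rle_trans; [apply Cmod_triangle|]. rewrite Cmod_opp, Cmod_circle by lra. lra. }
  apply Rplus_le_compat; [exact A1|].
  rewrite Cmod_mult, Cmod_R.
  apply Rmult_le_compat; [apply Rabs_pos|apply Cmod_ge_0|lra|exact A2]. }
assert (Hder := fun s Hs => RInt_param_derive F F' m K a 0 (2 * PI) s HF Hm HK (HD s Hs)).
assert (E : forall s, 0 < s < 1 -> is_derive Phi s 0).
{ intros s Hs. assert (Hs' : 0 <= s <= 1) by lra.
  replace 0 with (RInt (fun t => Re (F' (a + s * m t) * m t * K t)%C) 0 (2 * PI)); [now apply Hder|].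
  assert (Es : forall t, (a + s * m t = (1 - s)%R * a + (s * rho)%R * cis t)%C).
  { intros t. unfold m. rewrite RtoC_minus, RtoC_mult. ring. }
  transitivity (RInt (fun t => Re ((rho * F' ((1 - s)%R * a + (s * rho)%R * cis t)) * cis t)%C) 0 (2 * PI)).
  { apply RInt_ext. intros t _. f_equal. rewrite Es. unfold K. fold (m t). field. apply Hm0. }
  apply (RInt_circle_derivative (fun z => rho * F z)%C (fun z => rho * F' z)%C).
  - now apply holo_scal.
  - intros X. apply RtoC_inj in X. nra.
  - intros t. rewrite <- Es. exact (locally_singleton _ _ (HD s Hs') t). }
destruct (MVT_gen Phi 0 1 (fun _ => 0)) as (c & _ & Hc).
- intros x. rewrite Rmin_left, Rmax_right by lra. apply E.
- intros x. rewrite Rmin_left, Rmax_right by lra. intros Hx.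
  apply continuity_pt_filterlim.
  apply (ex_derive_continuous (K := R_AbsRing) (V := R_NormedModule)).
  eexists. now apply Hder.
- transitivity (Phi 1); [|transitivity (Phi 0); [lra|]]; unfold Phi; apply RInt_ext; intros t _;
    do 3 f_equal; unfold m; ring.
Qed.

(** The case [a = 0] of [cauchy_circle], where the kernel is [1]. *)
Lemma mean_value (F F' : C -> C) (rho : R) :
  holo F F' -> 0 <= rho < 1 ->
  RInt (fun t => Re (F (rho * cis t)%C)) 0 (2 * PI) = 2 * PI * Re (F 0).
Proof.
intros HF [Hrho0 Hrho1]. destruct Hrho0 as [Hrho0|<-].
2:{ rewrite (RInt_ext _ (fun _ => Re (F 0))).
  - rewrite RInt_const. unfold scal; simpl; unfold mult; simpl. ring.
  - intros t _. now rewrite Cmult_0_l. }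
assert (Hr0 : RtoC rho <> 0) by (intros X; apply RtoC_inj in X; lra).
assert (H : forall t, (rho * cis t / (rho * cis t - 0))%C = 1).
{ intros t. field. split; [apply cis_neq_0|assumption]. }
transitivity (RInt (fun t => Re (F 0 * (rho * cis t / (rho * cis t - 0)))%C) 0 (2 * PI)).
- rewrite <- (cauchy_circle F F' 0 rho HF); [|rewrite Cmod_0; lra|lra].
  apply RInt_ext. intros t _. rewrite H. f_equal. ring.
- rewrite (RInt_ext _ (fun _ => Re (F 0))).
  + rewrite RInt_const. unfold scal; simpl; unfold mult; simpl. ring.
  + intros t _. rewrite H. f_equal. ring.
Qed.

(** * Functions with positive real part *)

Lemma ex_RInt_Re (g : R -> C) (b c : R) :
  (forall t, continuous g t) -> ex_RInt (fun t => Re (g t)) b c.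
Proof.
intros H. apply (ex_RInt_continuous (V := R_CompleteNormedModule)). intros t _.
apply continuous_Re_comp, H.
Qed.

Lemma unit_disk_circle (rho t : R) : 0 <= rho < 1 -> unit_disk (rho * cis t)%C.
Proof. intros H. unfold unit_disk. rewrite Cmod_circle; lra. Qed.

Lemma continuous_on_circle F F' (rho t : R) :
  holo F F' -> 0 <= rho < 1 -> continuous (fun t => F (rho * cis t)%C) t.
Proof.
intros HF Hr. apply (continuous_comp (fun t => rho * cis t)%C F).
- apply continuous_Cmult; [apply continuous_const|apply continuous_cis].
- eapply holo_continuous; [exact HF|now apply unit_disk_circle].
Qed.

Lemma circle_kernel_bound (r rho t : R) :
  0 <= r < rho -> Re (rho * cis t / (rho * cis t - r)) <= rho / (rho - r).
Proof.
intros H.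
assert (Hr : Cmod r = r) by (rewrite Cmod_R, Rabs_pos_eq; lra).
assert (H0 : (rho * cis t - r)%C <> 0) by (apply circle_minus_neq_0; lra).
assert (Hm : rho - r <= Cmod (rho * cis t - r)).
{ assert (X := Cmod_triangle (rho * cis t - r) r).
  replace (rho * cis t - r + r)%C with (rho * cis t)%C in X by ring.
  rewrite Cmod_circle in X by lra. lra. }
eapply Rle_trans; [apply Rle_abs|]. eapply Rle_trans; [apply re_le_Cmod|].
rewrite Cmod_div, Cmod_circle by (auto; lra).
apply Rmult_le_compat_l; [lra|]. apply Rinv_le_contravar; lra.
Qed.

Lemma reflected_kernel_neq_0 (r rho : R) (z : C) :
  0 <= r < rho * rho -> unit_disk z ->
  ((rho * rho)%R + (- r)%R * z)%C <> RtoC 0.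
Proof.
intros Hr Hz E.
assert (X : (r * z)%C = (rho * rho)%R).
{ rewrite RtoC_opp in E.
  replace (r * z)%C with ((rho * rho)%R - ((rho * rho)%R + - r * z))%C by ring.
  rewrite E. ring. }
apply (f_equal Cmod) in X. rewrite Cmod_mult, !Cmod_R, !Rabs_pos_eq in X by nra.
unfold unit_disk in Hz. assert (Y := Cmod_ge_0 z). nra.
Qed.

(** On the circle the conjugate of the Cauchy kernel is the restriction of a
function holomorphic inside it: the pole [r] is reflected to [rho ^ 2 / r]. *)
Lemma circle_kernel_conj (r rho t : R) :
  0 <= r < rho * rho -> 0 < rho < 1 ->
  Cconj (rho * cis t / (rho * cis t - r))
    = ((rho * rho)%R * / ((rho * rho)%R + (- r)%R * (rho * cis t)))%C.
Proof.
intros Hr Hrho.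
assert (Hd : unit_disk (rho * cis t)%C) by (apply unit_disk_circle; lra).
assert (Hk := reflected_kernel_neq_0 r rho _ Hr Hd).
assert (H0 : (rho * cis t - r)%C <> 0).
{ apply circle_minus_neq_0. rewrite Cmod_R, Rabs_pos_eq; nra. }
set (K := (rho * cis t / (rho * cis t - r))%C).
assert (E : (K * (rho * cis t - r))%C = (rho * cis t)%C) by (unfold K; field; exact H0).
apply (f_equal Cconj) in E.
assert (CR : forall x : R, Cconj x = x).
{ intros x. unfold Cconj; simpl. now rewrite Ropp_0. }
rewrite Cmult_conj, Cminus_conj, Cmult_conj, !CR in E.
assert (E2 : (Cconj K * ((rho * rho)%R + (- r)%R * (rho * cis t)))%C = (rho * rho)%R).
{ rewrite RtoC_opp, RtoC_mult.
  replace (Cconj K * (rho * rho + - r * (rho * cis t)))%C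
    with (rho * cis t * (Cconj K * (rho * Cconj (cis t) - r))
          + rho * rho * Cconj K * (1 - cis t * Cconj (cis t)))%C by ring.
  rewrite E, cis_conj.
  replace (rho * cis t * (rho * Cconj (cis t)))%C
    with (rho * rho * (cis t * Cconj (cis t)))%C by ring.
  rewrite cis_conj. ring. }
set (d := ((rho * rho)%R + (- r)%R * (rho * cis t))%C) in *.
rewrite <- E2. field. exact Hk.
Qed.

(** Integrating [P] against the Cauchy kernel [K] gives [P r], and against
its conjugate, which is holomorphic inside the circle, gives [P 0]. The sum is
the integral of [2 * Re P * Re K], where [Re P] is positive and
[Re K <= rho / (rho - r)]. *)
Lemma harnack_circle (P P' : C -> C) (r rho : R) :
  holo P P' -> (forall z, unit_disk z -> 0 < Re (P z)) ->
  0 <= r < rho * rho -> 0 < rho < 1 ->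
  Re (P r) + Re (P 0) <= 2 * (rho / (rho - r)) * Re (P 0).
Proof.
intros HP Hpos Hr Hrho.
assert (Hr' : 0 <= r < rho) by nra.
assert (Hrho' : 0 <= rho < 1) by lra.
set (K := fun t => (rho * cis t / (rho * cis t - r))%C).
set (k := fun z => ((rho * rho)%R * / ((rho * rho)%R + (- r)%R * z))%C).
assert (Hk0 : forall z, unit_disk z -> ((rho * rho)%R + (- r)%R * z)%C <> RtoC 0).
{ intros z. now apply reflected_kernel_neq_0. }
assert (Hk1 : k 0 = RtoC 1).
{ unfold k. field. intros X. apply RtoC_inj in X. nra. }
assert (HKk : forall t, Cconj (K t) = k (rho * cis t)%C).
{ intros t. now apply circle_kernel_conj. }
assert (Hk : exists k', holo k k').
{ eexists. apply holo_mult; [apply holo_const|].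
  apply holo_inv; [|exact Hk0].
  apply holo_plus; [apply holo_const|]. apply holo_mult; [apply holo_const|apply holo_id]. }
destruct Hk as [k' Hk].
assert (HK : forall t, continuous K t).
{ intros t. apply continuous_C_components.
  - apply (continuous_ext (fun t => Re (k (rho * cis t)%C))).
    { intros u. now rewrite <- HKk, re_conj. }
    apply continuous_Re_comp. eapply continuous_on_circle; [exact Hk|lra].
  - apply (continuous_ext (fun t => Re (Ci * k (rho * cis t))%C)).
    { intros u. rewrite <- HKk. unfold Re, Im; simpl. ring. }
    apply continuous_Re_comp, continuous_Cmult; [apply continuous_const|].
    eapply continuous_on_circle; [exact Hk|lra]. }
assert (HPc : forall t, continuous (fun t => P (rho * cis t)%C) t).
{ intros t. eapply continuous_on_circle; [exact HP|lra]. }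
assert (I1 : RInt (fun t => Re (P (rho * cis t) * K t)%C) 0 (2 * PI) = 2 * PI * Re (P r)).
{ transitivity (RInt (fun t => Re (P r * K t)%C) 0 (2 * PI)).
  - apply (cauchy_circle P P' r rho HP); [rewrite Cmod_R, Rabs_pos_eq; lra|lra].
  - transitivity (RInt (fun t => Re (Cconj (P r) * k (rho * cis t))%C) 0 (2 * PI)).
    + apply RInt_ext. intros t _. rewrite <- HKk, <- Cmult_conj. now rewrite re_conj.
    + assert (Hck := holo_mult _ _ _ _ (holo_const (Cconj (P r))) Hk).
      rewrite (mean_value _ _ rho Hck Hrho').
      f_equal. rewrite Hk1, Cmult_1_r. apply re_conj. }
assert (I2 : RInt (fun t => Re (P (rho * cis t) * Cconj (K t))%C) 0 (2 * PI) = 2 * PI * Re (P 0)).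
{ transitivity (RInt (fun t => Re (P (rho * cis t) * k (rho * cis t))%C) 0 (2 * PI)).
  - apply RInt_ext. intros t _. now rewrite HKk.
  - assert (Hck := holo_mult _ _ _ _ HP Hk).
    rewrite (mean_value _ _ rho Hck Hrho').
    now rewrite Hk1, Cmult_1_r. }
assert (I3 := mean_value P P' rho HP Hrho').
assert (HPI := PI_RGT_0).
assert (E1 : ex_RInt (fun t => Re (P (rho * cis t) * K t)%C) 0 (2 * PI)).
{ apply ex_RInt_Re. intros t. now apply continuous_Cmult. }
assert (E2 : ex_RInt (fun t => Re (P (rho * cis t) * Cconj (K t))%C) 0 (2 * PI)).
{ apply ex_RInt_Re. intros t. apply continuous_Cmult; [apply HPc|].
  apply continuous_C_components; simpl.
  - apply (continuous_Re_comp K), HK.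
  - apply (continuous_opp (K := R_AbsRing) (V := R_NormedModule) (fun u => Im (K u))).
    apply (continuous_Im_comp K), HK. }
assert (E3 : ex_RInt (fun t => Re (P (rho * cis t)%C)) 0 (2 * PI)) by now apply ex_RInt_Re.
assert (L : RInt (fun t => plus (Re (P (rho * cis t) * K t)%C) (Re (P (rho * cis t) * Cconj (K t))%C)) 0 (2 * PI)
  <= RInt (fun t => scal (2 * (rho / (rho - r))) (Re (P (rho * cis t)%C))) 0 (2 * PI)).
{ apply RInt_le; [lra|now apply (ex_RInt_plus (V := R_NormedModule))|now apply (ex_RInt_scal (V := R_NormedModule))|].
  intros t _.
  assert (B := circle_kernel_bound r rho t Hr'). fold (K t) in B.
  assert (U := Hpos _ (unit_disk_circle rho t (conj (Rlt_le _ _ (proj1 Hrho)) (proj2 Hrho)))).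
  unfold plus, scal; simpl; unfold mult; simpl.
  change (fst (P ?x)) with (Re (P x)).
  replace (_ + _) with (2 * (Re (K t) * Re (P (rho * cis t)%C))) by (unfold Re, Im; simpl; ring).
  rewrite Rmult_assoc. apply Rmult_le_compat_l; [lra|]. apply Rmult_le_compat_r; [lra|exact B]. }
rewrite (RInt_plus (V := R_CompleteNormedModule)) in L by assumption.
rewrite (RInt_scal (V := R_CompleteNormedModule)) in L by assumption.
rewrite I1, I2, I3 in L. unfold plus, scal in L; simpl in L; unfold mult in L; simpl in L.
apply Rmult_le_reg_l with (2 * PI); [lra|].
rewrite <- Rmult_plus_distr_l in L. eapply Rle_trans; [exact L|right]. ring.
Qed.

(** Let the radius tend to [1] in [harnack_circle]; the failure of the bound
by a margin [d] is contradicted at radius [1 - e] for an explicit [e]. *)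
Lemma harnack (P P' : C -> C) (r : R) :
  holo P P' -> (forall z, unit_disk z -> 0 < Re (P z)) -> P 0 = 1 -> 0 <= r < 1 ->
  Re (P r) <= (1 + r) / (1 - r).
Proof.
intros HP Hpos H0 Hr.
set (x := Re (P r)).
assert (Hx : 0 < x).
{ apply Hpos. unfold unit_disk. rewrite Cmod_R, Rabs_pos_eq; lra. }
apply Rle_div_r; [lra|]. apply Rnot_lt_le. intros Hlt.
assert (Hx1 : 1 < x) by nra.
set (d := (x - 1) - (x + 1) * r). assert (Hd : 0 < d) by (unfold d; lra).
set (e := Rmin ((1 - r) / 4) (d / (2 * (x - 1)))).
assert (He : 0 < e).
{ apply Rmin_pos; [lra|]. apply Rdiv_lt_0_compat; lra. }
assert (He1 : e <= (1 - r) / 4) by apply Rmin_l.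
assert (He2 : e * (x - 1) <= d / 2).
{ replace (d / 2) with (d / (2 * (x - 1)) * (x - 1)) by (field; lra).
  apply Rmult_le_compat_r; [lra|apply Rmin_r]. }
assert (H := harnack_circle P P' r (1 - e) HP Hpos).
rewrite H0 in H. fold x in H. simpl in H.
assert (H' : x + 1 <= 2 * ((1 - e) / (1 - e - r)) * 1) by (apply H; nra).
assert (Hp : 0 < 1 - e - r) by lra.
apply Rmult_le_compat_r with (r := 1 - e - r) in H'; [|lra].
replace (2 * ((1 - e) / (1 - e - r)) * 1 * (1 - e - r)) with (2 * (1 - e)) in H' by (field; lra).
unfold d in *. lra.
Qed.

(** The primitive along a ray of [Im P r / r] is an argument, and this is
where its boundedness comes from: up to a constant it equals the integral of
[t / (2 * PI) * Re (P (r * cis t))] over a full turn, whose weight lies between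
[0] and [1] while [Re P] is positive of mean [1]. The formula for its
derivative comes from the Cauchy-Riemann equations, the radial derivative of
[Re P] being the angular derivative of [Im P] divided by [r], and an
integration by parts in [t]. *)
Lemma conjugate_primitive (P P' : C -> C) :
  holo P P' -> (forall z, unit_disk z -> 0 < Re (P z)) -> P 0 = 1 ->
  exists W : R -> R,
    (forall r, 0 <= r < 1 -> 0 <= W r <= 2 * PI) /\
    (forall r, 0 <= r < 1 -> continuous W r) /\
    (forall r, 0 < r < 1 -> is_derive W r (Im (P r) / r)).
Proof.
intros HP Hpos H0. assert (HPI := PI_RGT_0).
set (K := fun t : R => RtoC (t / (2 * PI))).
assert (HK : forall t, continuous K t).
{ intros t. apply continuous_C_components; simpl; [|apply continuous_const].
  apply (continuous_mult (K := R_AbsRing)); [apply continuous_id|apply continuous_const]. }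
set (W := fun r : R => RInt (fun t => Re (P (0 + r * cis t) * K t)%C) 0 (2 * PI)).
assert (HD : forall r, 0 <= r < 1 -> locally r (fun u : R => forall t, unit_disk (0 + u * cis t)%C)).
{ intros r Hr. assert (He : 0 < 1 - r) by lra. exists (mkposreal _ He). intros u Hu t.
  assert (Hu' : Rabs (u - r) < 1 - r) by exact Hu. apply Rabs_def2 in Hu'.
  unfold unit_disk. rewrite Cplus_0_l, Cmod_mult, Cmod_cis, Cmod_R, Rmult_1_r.
  apply Rabs_def1; lra. }
assert (Hder := fun r Hr => RInt_param_derive P P' cis K 0 0 (2 * PI) r HP continuous_cis HK (HD r Hr)).
assert (Hcirc : forall (G G' : C -> C) (r t : R), holo G G' -> 0 <= r < 1 -> continuous (fun t => G (0 + r * cis t)%C) t).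
{ intros G G' r t HG Hr. apply continuous_circle. eapply holo_continuous; [exact HG|].
  rewrite Cplus_0_l. now apply unit_disk_circle. }
exists W. split; [|split].
- intros r Hr'.
  assert (E1 : ex_RInt (fun t => Re (P (0 + r * cis t) * K t)%C) 0 (2 * PI)).
  { apply ex_RInt_Re. intros t. apply continuous_Cmult; [|apply HK]. now apply (Hcirc P P'). }
  assert (E2 : ex_RInt (fun t => Re (P (r * cis t)%C)) 0 (2 * PI)).
  { apply ex_RInt_Re. intros t. now apply (continuous_on_circle P P'). }
  assert (B : forall t, 0 < t < 2 * PI ->
    0 <= Re (P (0 + r * cis t) * K t)%C <= Re (P (r * cis t)%C)).
  { intros t Ht. rewrite Cplus_0_l.
    assert (U := Hpos _ (unit_disk_circle r t Hr')).
    unfold K. rewrite re_scal_r.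
    assert (T : 0 <= t / (2 * PI) <= 1).
    { split; [apply Rdiv_le_0_compat; lra|apply Rle_div_l; lra]. }
    nra. }
  split.
  + apply RInt_ge_0; [lra|exact E1|]. intros t Ht. now apply B.
  + replace (2 * PI) with (RInt (fun t => Re (P (r * cis t)%C)) 0 (2 * PI)).
    * apply RInt_le; [lra|exact E1|exact E2|]. intros t Ht. now apply B.
    * rewrite (mean_value P P' r HP) by lra. rewrite H0. simpl. ring.
- intros r Hr. apply (ex_derive_continuous (K := R_AbsRing) (V := R_NormedModule)).
  eexists. now apply Hder.
- intros r Hr. assert (Hr' : 0 <= r < 1) by lra.
  assert (Hrc : RtoC r <> 0) by (intros X; apply RtoC_inj in X; lra).
  assert (HCi := Ci_neq_0).
  replace (Im (P r) / r) with (RInt (fun t => Re (P' (0 + r * cis t) * cis t * K t)%C) 0 (2 * PI));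
    [now apply Hder|].
  (* [V] is [Im P / r] on the circle and [dV] its angular derivative; the mean
     of [V] vanishes because [P 0] is real. *)
  set (V := fun t => Re (P (0 + r * cis t) * / (r * Ci))%C).
  set (dV := fun t => Re (P' (0 + r * cis t) * cis t)%C).
  assert (HV : forall t, is_derive V t (dV t)).
  { intros t. unfold dV. replace (P' (0 + r * cis t) * cis t)%C
      with ((r * (Ci * cis t)) * P' (0 + r * cis t) * / (r * Ci))%C by (field; auto).
    apply (is_derive_Re_comp P (fun t => 0 + r * cis t)%C).
    - apply HP. rewrite Cplus_0_l. now apply unit_disk_circle.
    - apply is_curve_derive_circle. }
  assert (HdV : forall t, continuous dV t).
  { intros t. apply continuous_Re_comp, continuous_Cmult; [|apply continuous_cis].
    apply continuous_circle. apply HP. rewrite Cplus_0_l. now apply unit_disk_circle. }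
  assert (CV : forall t, continuous V t).
  { intros t. apply (ex_derive_continuous (K := R_AbsRing) (V := R_NormedModule)). eexists. apply HV. }
  assert (HVint : RInt V 0 (2 * PI) = 0).
  { assert (HQ : holo (fun z => P z * / (r * Ci))%C (fun z => P' z * / (r * Ci) + P z * 0)%C)
      by exact (holo_mult _ _ _ _ HP (holo_const _)).
    transitivity (RInt (fun t => Re (P (r * cis t) * / (r * Ci))%C) 0 (2 * PI)).
    - apply RInt_ext. intros t _. unfold V. now rewrite Cplus_0_l.
    - rewrite (mean_value _ _ r HQ Hr'), H0.
      replace (1 * / (r * Ci))%C with (- ((/ r)%R * Ci))%C.
      + unfold Re; simpl. ring.
      + rewrite RtoC_inv by lra. field_simplify_eq; [|auto].
        apply injective_projections; simpl; ring. }
  assert (HVr : V (2 * PI) = Im (P r) / r).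
  { unfold V. rewrite cis_2PI, Cplus_0_l, Cmult_1_r.
    replace (/ (r * Ci))%C with (- ((/ r)%R * Ci))%C.
    - unfold Re, Im; simpl. unfold Rdiv. ring.
    - rewrite RtoC_inv by lra. field_simplify_eq; [|auto].
      apply injective_projections; simpl; ring. }
  assert (I := is_RInt_derive (V := R_CompleteNormedModule)
     (fun t => t / (2 * PI) * V t) (fun t => / (2 * PI) * V t + t / (2 * PI) * dV t) 0 (2 * PI)).
  assert (I' : RInt (fun t => / (2 * PI) * V t + t / (2 * PI) * dV t) 0 (2 * PI) = V (2 * PI)).
  { apply is_RInt_unique. replace (V (2 * PI)) with
      (minus (2 * PI / (2 * PI) * V (2 * PI)) (0 / (2 * PI) * V 0)).
    - apply I; intros t _.
      + apply (is_derive_mult (K := R_AbsRing) (fun t => t / (2 * PI)) V t (/ (2 * PI)) (dV t)).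
        * auto_derive; auto; field; lra.
        * apply HV.
        * apply Rmult_comm.
      + apply (continuous_plus (K := R_AbsRing) (V := R_NormedModule));
          apply (continuous_mult (K := R_AbsRing)); auto using @continuous_const.
        apply (continuous_mult (K := R_AbsRing)); [apply continuous_id|apply continuous_const].
    - unfold minus, plus, opp; simpl. field. lra. }
  rewrite <- HVr, <- I'.
  transitivity (RInt (fun t => minus (/ (2 * PI) * V t + t / (2 * PI) * dV t) (scal (/ (2 * PI)) (V t))) 0 (2 * PI)).
  { apply RInt_ext. intros t _. unfold K, dV, minus, plus, opp, scal; simpl; unfold mult; simpl. ring. }
  assert (EV : ex_RInt V 0 (2 * PI)).
  { apply (ex_RInt_continuous (V := R_CompleteNormedModule)). auto. }
  rewrite (RInt_minus (V := R_CompleteNormedModule)), (RInt_scal (V := R_CompleteNormedModule)), HVint.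
  + unfold minus, plus, opp, scal; simpl; unfold mult; simpl. ring.
  + exact EV.
  + apply (ex_RInt_continuous (V := R_CompleteNormedModule)). intros t _.
    apply (continuous_plus (K := R_AbsRing) (V := R_NormedModule));
      apply (continuous_mult (K := R_AbsRing)); auto using @continuous_const.
    apply (continuous_mult (K := R_AbsRing)); [apply continuous_id|apply continuous_const].
  + now apply (ex_RInt_scal (V := R_NormedModule)).
Qed.

(** * Robertson functions *)

Lemma analytic_holo (f : C -> C) :
  analytic_on unit_disk f -> holo f (C_derive f) /\ analytic_on unit_disk (C_derive f).
Proof.
intros Hf. destruct (analytic_derive _ _ Hf) as [Hd Ha]. split; [|exact Ha].
intros z Hz. split; [now apply Hd|].
destruct (analytic_derive _ _ Ha) as [Hd2 _].
eapply is_cderive_continuous. now apply Hd2.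
Qed.

(** Solving [cis (- lam) * (1 + q) = cos lam * P - Ci * sin lam] for [P]; the
imaginary constant normalises [P 0 = 1]. *)
Lemma robertson_caratheodory (lam : R) (f : C -> C) :
  0 < cos lam -> Robertson lam f ->
  exists P P' : C -> C, holo P P' /\
    (forall z, unit_disk z -> 0 < Re (P z)) /\ P 0 = 1 /\
    forall z, unit_disk z ->
      (z * C_derive (C_derive f) z / C_derive f z
        = cos lam * cis lam * (P z - 1))%C.
Proof.
intros Hcos [[Hf _] HR].
destruct (analytic_holo _ Hf) as [_ Hf1].
destruct (analytic_holo _ Hf1) as [H1 Hf2].
destruct (analytic_holo _ Hf2) as [H2 _].
set (f1 := C_derive f) in *. set (f2 := C_derive f1) in *.
assert (Hnz : forall z, unit_disk z -> f1 z <> 0) by (intros z Hz; now apply HR).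
set (k := ((/ cos lam)%R * cis (- lam))%C).
assert (Hk : (cos lam * cis lam * k)%C = 1).
{ unfold k. rewrite RtoC_inv by lra.
  replace (cos lam * cis lam * (/ cos lam * cis (- lam)))%C with (cis lam * cis (- lam))%C.
  - unfold cis. rewrite cos_neg, sin_neg. rewrite <- (cis_conj lam). reflexivity.
  - field. intros X. apply RtoC_inj in X. lra. }
exists (fun z => 1 + k * (z * f2 z * / f1 z))%C. eexists. split; [|split; [|split]].
- apply holo_plus; [apply holo_const|]. apply holo_mult; [apply holo_const|].
  apply holo_mult; [|apply holo_inv; [exact H1|exact Hnz]].
  apply holo_mult; [apply holo_id|exact H2].
- intros z Hz. destruct (HR z Hz) as [_ Hre].
  set (q := (z * f2 z / f1 z)%C) in *.
  replace (Re (1 + k * (z * f2 z * / f1 z))) with (/ cos lam * Re (cis (- lam) * (1 + q))).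
  + apply Rmult_lt_0_compat; [now apply Rinv_0_lt_compat|exact Hre].
  + change (z * f2 z * / f1 z)%C with q. clearbody q. unfold k, cis, Re. simpl. rewrite cos_neg.
    field. lra.
- ring.
- intros z Hz. unfold Cdiv.
  replace (cos lam * cis lam * (1 + k * (z * f2 z * / f1 z) - 1))%C
    with (cos lam * cis lam * k * (z * f2 z * / f1 z))%C by ring.
  rewrite Hk. ring.
Qed.

Lemma nonincreasing_from_0 (f df : R -> R) (b : R) :
  0 <= b -> (forall x, 0 <= x <= b -> continuous f x) ->
  (forall x, 0 < x < b -> is_derive f x (df x) /\ df x <= 0) -> f b <= f 0.
Proof.
intros Hb Hc Hd. destruct Hb as [Hb|<-]; [|lra].
(* The intermediate point may be an endpoint, where [df] is unconstrained;
   truncating at [0] fixes the sign there. *)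
destruct (MVT_gen f 0 b (fun x => Rmin (df x) 0)) as (c & _ & E).
- rewrite Rmin_left, Rmax_right by lra. intros x Hx. destruct (Hd x Hx) as [H1 H2].
  now rewrite Rmin_left.
- rewrite Rmin_left, Rmax_right by lra. intros x Hx.
  now apply continuity_pt_filterlim, Hc.
- assert (H := Rmin_r (df c) 0). nra.
Qed.

Lemma is_curve_derive_ray (e : C) (t : R) : is_curve_derive (fun t : R => t * e)%C t e.
Proof. split; unfold Re, Im; simpl; auto_derive; auto; ring. Qed.

Lemma is_derive_ln_Cmod_comp (F : C -> C) (g : R -> C) (t : R) (v l : C) :
  is_cderive F (g t) l -> is_curve_derive g t v -> F (g t) <> 0 ->
  is_derive (fun u => ln (Cmod (F (g u)))) t (Re (v * l / F (g t))).
Proof.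
intros HF Hg H0.
assert (DR := is_derive_Re_comp F g t v l 1 HF Hg).
assert (DI := is_derive_Re_comp F g t v l (- Ci) HF Hg).
set (x := fun u => Re (F (g u) * 1)) in DR.
set (y := fun u => Re (F (g u) * - Ci)) in DI.
assert (Ex : x t = Re (F (g t))) by (unfold x, Re; simpl; ring).
assert (Ey : y t = Im (F (g t))) by (unfold y, Re, Im; simpl; ring).
assert (Hpos : 0 < x t * x t + y t * y t).
{ rewrite Ex, Ey. assert (X := proj1 (Cmod_gt_0 _) H0).
  replace (_ + _) with (Cmod (F (g t)) ^ 2); [apply pow_lt, X|].
  rewrite Cmod2_alt. ring. }
apply (is_derive_ext (fun u => ln (sqrt (x u * x u + y u * y u)))).
{ intros u. unfold Cmod. do 2 f_equal. unfold x, y, Re; simpl. ring. }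
replace (Re (v * l / F (g t))) with
  ((Re (v * l * 1) * x t + Re (v * l * - Ci) * y t) / (x t * x t + y t * y t)).
- assert (Hs := sqrt_lt_R0 _ Hpos).
  auto_derive.
  + repeat split; try (eexists; eassumption); auto.
  + replace (Derive (fun x0 => x x0) t) with (Re (v * l * 1)) by (symmetry; now apply is_derive_unique).
    replace (Derive (fun x0 => y x0) t) with (Re (v * l * - Ci)) by (symmetry; now apply is_derive_unique).
    rewrite <- (sqrt_sqrt (x t * x t + y t * y t)) at 3 by lra.
    field. lra.
- rewrite Ex, Ey in Hpos |- *. clear - Hpos. destruct (F (g t)) as [a b]. destruct (v * l)%C as [c d].
  unfold Re, Im in *; simpl in *. field. nra.
Qed.

Lemma unit_disk_ray (e : C) (r : R) : Cmod e = 1 -> 0 <= r < 1 -> unit_disk (r * e)%C.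
Proof. intros He Hr. unfold unit_disk. rewrite Cmod_mult, Cmod_R, He, Rabs_pos_eq; lra. Qed.

(** Along a ray the derivative of [ln |f'|] is [Re q / t], with
[q = cos lam * cis lam * (P - 1)]. Its part in [Re P - 1] is at most
[2 * cos lam ^ 2 / (1 - t)] by [harnack]. Its part in [Im P] is, up to the
factor [- sin lam * cos lam], the derivative of the bounded function of
[conjugate_primitive]. Hence the compensated function [Psi] is nonincreasing. *)
Lemma robertson_derivative_growth (lam : R) (f : C -> C) (e : C) (r : R) :
  0 < cos lam -> Robertson lam f -> Cmod e = 1 -> 0 <= r < 1 ->
  Cmod (C_derive f (r * e)) <= exp (2 * PI) * exp (- (2 * cos lam ^ 2) * ln (1 - r)).
Proof.
intros Hcos HR He Hr.
destruct (robertson_caratheodory lam f Hcos HR) as (P & P' & HP & Hpos & HP0 & HPq).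
destruct HR as [[Hf [_ Hf10]] HR].
destruct (analytic_holo _ Hf) as [_ Hf1].
destruct (analytic_holo _ Hf1) as [H1 _].
set (f1 := C_derive f) in *. set (f2 := C_derive f1) in *.
assert (HPe := holo_scale P P' e (Req_le _ _ He) HP).
set (Pe := fun z => P (e * z)%C) in HPe.
assert (Hpose : forall z, unit_disk z -> 0 < Re (Pe z)).
{ intros z Hz. apply Hpos. unfold unit_disk in *. rewrite Cmod_mult, He. lra. }
assert (HPe0 : Pe 0 = 1) by (unfold Pe; now rewrite Cmult_0_r).
destruct (conjugate_primitive Pe _ HPe Hpose HPe0) as (W & WB & WC & WD).
set (kap := cos lam) in *. set (sig := sin lam).
set (Psi := fun t : R => ln (Cmod (f1 (t * e)%C)) + sig * kap * W t + 2 * kap ^ 2 * ln (1 - t)).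
assert (HlnD : forall t : R, 0 <= t < 1 -> is_derive (fun t : R => ln (Cmod (f1 (t * e)%C))) t
   (Re (e * f2 (t * e) / f1 (t * e))%C)).
{ intros t Ht. assert (Hte := unit_disk_ray e t He Ht).
  apply (is_derive_ln_Cmod_comp f1 (fun t : R => t * e)%C); [now apply H1|apply is_curve_derive_ray|].
  now apply HR. }
assert (Hmono : Psi r <= Psi 0).
{ apply (nonincreasing_from_0 Psi (fun t : R =>
    Re (e * f2 (t * e) / f1 (t * e))%C + sig * kap * (Im (Pe t) / t) + 2 * kap ^ 2 * (- / (1 - t)))); [lra| |].
  - intros t Ht. assert (Ht' : 0 <= t < 1) by lra.
    apply (continuous_plus (K := R_AbsRing) (V := R_NormedModule)).
    + apply (continuous_plus (K := R_AbsRing) (V := R_NormedModule)).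
      * apply (ex_derive_continuous (K := R_AbsRing) (V := R_NormedModule)). eexists. now apply HlnD.
      * apply (continuous_scal_r (K := R_AbsRing) (V := R_NormedModule)). now apply WC.
    + apply (ex_derive_continuous (K := R_AbsRing) (V := R_NormedModule)). auto_derive. lra.
  - intros t Ht. assert (Ht' : 0 <= t < 1) by lra. split.
    + apply (is_derive_plus (K := R_AbsRing) (V := R_NormedModule)).
      * apply (is_derive_plus (K := R_AbsRing) (V := R_NormedModule)); [now apply HlnD|].
        apply (is_derive_scal W). now apply WD.
      * auto_derive; [lra|]. field. lra.
    + assert (Hte := unit_disk_ray e t He Ht').
      assert (Hharn := harnack Pe _ t HPe Hpose HPe0 Ht').
      assert (Hq := HPq _ Hte).
      replace (P (t * e)%C) with (Pe t) in Hq by (unfold Pe; now rewrite Cmult_comm).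
      replace (Re (e * f2 (t * e) / f1 (t * e))%C)
        with (kap ^ 2 * ((Re (Pe t) - 1) / t) - sig * kap * (Im (Pe t) / t)).
      2:{ assert (X := f_equal Re Hq).
          replace (t * e * f2 (t * e) / f1 (t * e))%C with (t * (e * f2 (t * e) / f1 (t * e)))%C in X
            by (unfold Cdiv; ring).
          rewrite re_scal_l in X.
          apply Rmult_eq_reg_l with t; [|lra]. rewrite X.
          unfold cis, Re, Im; simpl. fold kap sig. field. lra. }
      apply Rle_trans with (kap ^ 2 * ((Re (Pe t) - 1) / t - 2 / (1 - t))); [right; field; lra|].
      assert (Hb : (Re (Pe t) - 1) / t <= 2 / (1 - t)).
      { apply Rle_div_l; [lra|].
        replace (2 / (1 - t) * t) with ((1 + t) / (1 - t) - 1) by (field; lra). lra. }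
      assert (Hk2 := pow2_ge_0 kap). nra. }
assert (Hz : f1 (r * e)%C <> 0) by (apply HR; now apply unit_disk_ray).
apply Cmod_gt_0 in Hz.
rewrite <- exp_plus. rewrite <- (exp_ln _ Hz).
assert (HPsi0 : Psi 0 = sig * kap * W 0).
{ unfold Psi. rewrite Cmult_0_l, Hf10, Cmod_1, Rminus_0_r, ln_1. ring. }
rewrite HPsi0 in Hmono. unfold Psi in Hmono.
assert (HW : sig * kap * (W 0 - W r) <= 2 * PI).
{ assert (B0 := WB 0 (conj (Rle_refl 0) Rlt_0_1)). assert (Br := WB r Hr).
  assert (Hsk : Rabs (sig * kap) <= 1).
  { rewrite Rabs_mult, <- (Rmult_1_r 1). apply Rmult_le_compat; try apply Rabs_pos;
      apply Rabs_le; [apply SIN_bound|apply COS_bound]. }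
  eapply Rle_trans; [apply Rle_abs|]. rewrite Rabs_mult, <- (Rmult_1_l (2 * PI)).
  apply Rmult_le_compat; try apply Rabs_pos; [exact Hsk|apply Rabs_le; lra]. }
apply Rnot_lt_le. intros X. apply exp_lt_inv in X. lra.
Qed.

(** For [beta < 1] the growth bound is integrable along a ray. Rotating the
value [f (r * e)] onto the positive axis by the unit factor [k] reduces the
estimate of the modulus to the monotonicity of a real function. *)
Lemma bounded_of_derivative_growth (f f' : C -> C) (A beta : R) (e : C) (r : R) :
  holo f f' -> f 0 = 0 -> Cmod e = 1 -> 0 <= A -> beta < 1 ->
  (forall t, 0 <= t < 1 -> Cmod (f' (t * e)%C) <= A * exp (- beta * ln (1 - t))) ->
  0 <= r < 1 -> Cmod (f (r * e)%C) <= A / (1 - beta).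
Proof.
intros Hf Hf0 He HA Hbeta Hgr Hr.
destruct (Ceq_dec (f (r * e)%C) 0) as [E|Hw].
{ rewrite E, Cmod_0. apply Rdiv_le_0_compat; lra. }
set (w := f (r * e)%C) in *.
assert (Hwp := proj1 (Cmod_gt_0 w) Hw).
set (k := (Cconj w * (/ Cmod w)%R)%C).
assert (Hk : Cmod k = 1).
{ unfold k. rewrite Cmod_mult, Cmod_conj, Cmod_R, Rabs_pos_eq; [field; lra|].
  left. now apply Rinv_0_lt_compat. }
assert (Hwk : Re (w * k) = Cmod w).
{ unfold k. rewrite Cmult_assoc, <- Cmod2_conj, <- RtoC_mult. simpl. field. lra. }
set (h := fun t : R => Re (f (t * e) * k)%C + A / (1 - beta) * exp ((1 - beta) * ln (1 - t))).
assert (Hd : forall t, 0 <= t < 1 -> is_derive h t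
  (Re (e * f' (t * e) * k)%C + - (A * exp (- beta * ln (1 - t))))).
{ intros t Ht. apply (is_derive_plus (K := R_AbsRing) (V := R_NormedModule)).
  - apply (is_derive_Re_comp f (fun t : R => t * e)%C); [|apply is_curve_derive_ray].
    apply Hf. now apply unit_disk_ray.
  - auto_derive; [lra|].
    replace ((1 - beta) * ln (1 - t)) with (- beta * ln (1 - t) + ln (1 - t)) by ring.
    replace (1 + - t) with (1 - t) by ring.
    replace ((1 - beta) * ln (1 - t)) with (- beta * ln (1 - t) + ln (1 - t)) by ring.
    rewrite exp_plus, exp_ln by lra. field. lra. }
assert (Hmono : h r <= h 0).
{ apply (nonincreasing_from_0 h (fun t : R => Re (e * f' (t * e) * k)%C
    + - (A * exp (- beta * ln (1 - t))))); [lra| |].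
  - intros t Ht. apply (ex_derive_continuous (K := R_AbsRing) (V := R_NormedModule)).
    eexists. apply Hd. lra.
  - intros t Ht. assert (Ht' : 0 <= t < 1) by lra. split; [now apply Hd|].
    assert (X := Hgr t Ht').
    assert (Y := Rle_trans _ _ _ (Rle_abs _) (re_le_Cmod (e * f' (t * e) * k)%C)).
    rewrite !Cmod_mult, He, Hk in Y. lra. }
assert (H0 : h 0 = A / (1 - beta)).
{ unfold h. rewrite Cmult_0_l, Hf0, Cmult_0_l, Rminus_0_r, ln_1, Rmult_0_r, exp_0. simpl. ring. }
rewrite H0 in Hmono. unfold h in Hmono. fold w in Hmono. rewrite Hwk in Hmono.
assert (X : 0 <= A / (1 - beta) * exp ((1 - beta) * ln (1 - r))).
{ apply Rmult_le_pos; [apply Rdiv_le_0_compat; lra|left; apply exp_pos]. }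
lra.
Qed.

Theorem theorem1 (lam : R) (hlam : - PI / 2 < lam < PI / 2)
  (hcos : cos lam < 1 / sqrt 2) (f : C -> C) (hf : Robertson lam f) :
  bounded_on unit_disk f.
Proof.
assert (Hcos : 0 < cos lam) by (apply cos_gt_0; lra).
assert (Hbeta : 2 * cos lam ^ 2 < 1).
{ assert (Hs : 0 < sqrt 2) by (apply sqrt_lt_R0; lra).
  apply Rlt_div_r in hcos; [|exact Hs].
  assert (H2 : sqrt 2 * sqrt 2 = 2) by (apply sqrt_sqrt; lra).
  assert (E : 2 * cos lam ^ 2 = (cos lam * sqrt 2) * (cos lam * sqrt 2)).
  { replace (cos lam * sqrt 2 * (cos lam * sqrt 2))
      with (sqrt 2 * sqrt 2 * cos lam ^ 2) by ring. now rewrite H2. }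
  rewrite E.
  assert (0 < cos lam * sqrt 2) by now apply Rmult_lt_0_compat.
  nra. }
destruct (analytic_holo f (proj1 (proj1 hf))) as [Hf _].
assert (Hf0 : f 0 = 0) by apply hf.
exists (exp (2 * PI) / (1 - 2 * cos lam ^ 2)). intros z Hz.
assert (HB := fun e r => bounded_of_derivative_growth f (C_derive f) (exp (2 * PI))
  (2 * cos lam ^ 2) e r Hf Hf0).
destruct (Ceq_dec z 0) as [->|Hz0].
- rewrite Hf0, Cmod_0. apply Rdiv_le_0_compat; [left; apply exp_pos|lra].
- assert (Hp := proj1 (Cmod_gt_0 z) Hz0).
  set (e := (z * (/ Cmod z)%R)%C).
  assert (He : Cmod e = 1).
  { unfold e. rewrite Cmod_mult, Cmod_R, Rabs_pos_eq; [field; lra|].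
    left. now apply Rinv_0_lt_compat. }
  assert (Hze : z = (Cmod z * e)%C).
  { unfold e. rewrite RtoC_inv by lra. field. intros X. apply RtoC_inj in X. lra. }
  unfold unit_disk in Hz.
  rewrite Hze. apply HB; [exact He|left; apply exp_pos|exact Hbeta| |lra].
  intros t Ht. now apply robertson_derivative_growth.
Qed.
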